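(* Let $G$ be a connected simple graph on $n$ vertices, let $k\geq 1$ be an integer, and let $X\subseteq E(G)$ satisfy $|X|\leq k$. If $d(x)+d(y)\geq n+k$ for every edge $xy\in E(G)$, then either $G$ has a spanning closed trail containing all edges of $X$, or $n$ is even and $G$ is isomorphic to $K_{2,n-2}^*$.
   Context: Graphs are finite. $d(v)$ denotes the degree of the vertex $v$ in $G$. A closed trail is a closed walk with no repeated edge (a single vertex counts as a trivial closed trail); it is spanning if it visits every vertex of $G$. Equivalently, a spanning closed trail is a connected spanning subgraph of $G$ in which every vertex has even degree. $K_{2,n-2}^*$ denotes the graph obtained from the complete bipartite graph $K_{2,n-2}$ by adding an edge joining the two vertices of degree $n-2$ (the two vertices of the part of size $2$). *)

(* Defs.v *)
From mathcomp Require Import all_boot.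

Set Implicit Arguments.
Unset Strict Implicit.
Unset Printing Implicit Defensive.

(* A finite simple graph is a symmetric irreflexive adjacency relation on a
   finType; its edges are the 2-element sets [set x; y] with x, y adjacent. *)
Definition simple_graph (T : finType) (e : rel T) : Prop :=
  symmetric e /\ irreflexive e.

Definition edges (T : finType) (e : rel T) : {set {set T}} :=
  [set [set p.1; p.2] | p : T * T & e p.1 p.2].

Definition degree (T : finType) (e : rel T) (x : T) : nat := #|[set y | e x y]|.

(* The graph on no vertices does not count as connected. *)
Definition connected_graph (T : finType) (e : rel T) : Prop :=
  0 < #|T| /\ forall x y : T, connect e x y.

(* As in path.v, a walk is given by its first vertex x and the sequence p of
   its following vertices; walk_edges lists the edges in order of traversal. *)
Definition walk_edges (T : finType) (x : T) (p : seq T) : seq {set T} :=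
  pairmap (fun u v => [set u; v]) x p.

(* p = [::] is the trivial closed trail at x. *)
Definition closed_trail (T : finType) (e : rel T) (x : T) (p : seq T) : bool :=
  [&& path e x p, last x p == x & uniq (walk_edges x p)].

Definition spanning (T : finType) (x : T) (p : seq T) : Prop :=
  forall v : T, v \in x :: p.

Definition isomorphic (T U : finType) (e : rel T) (r : rel U) : Prop :=
  exists2 f : T -> U, bijective f & forall x y : T, e x y = r (f x) (f y).

Definition complete_bipartite (a b : nat) : rel ('I_a + 'I_b) :=
  fun u v => match u, v with
             | inl _, inr _ | inr _, inl _ => true
             | _, _ => false
             end.

Definition add_edge (T : finType) (e : rel T) (a b : T) : rel T :=
  fun u v => e u v || ([set u; v] == [set a; b]).

Definition K2star (m : nat) : rel ('I_2 + 'I_m) :=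
  add_edge (@complete_bipartite 2 m) (inl ord0) (inl ord_max).

(* Main.v *)
Require Import Defs.
From mathcomp Require Import all_boot zify.

(** By Euler's theorem a spanning closed trail containing [X] is the same thing
as a set [H] of edges that contains [X], has even degree at every vertex and
connects all the vertices.  Such a set is found by an extremal argument.

Since [d(x) + d(y) >= n + k], every edge [xy] lies in at least [k] triangles,
and [N(x)] and [N(y)] cover the graph if there are exactly [k].  An edge of [X]
therefore lies in a triangle with no second edge of [X], since the other edges
of [X] are at most [k - 1] and each is a side of at most one triangle on the
given edge.
Adding such triangles modulo 2 gives an even set containing [X]
([even_cover]).

Let [H] be an even set containing [X] with as many edges as possible.  Replacing
[H] by its symmetric difference with a closed trail that avoids [X] cannot
increase its size, so [H] contains at least half of each such trail
([max_trail]).  In particular [H] has at least two edges of every triangle that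
avoids [X], and so connects the ends of each of its sides.

Suppose that [H] is not connected.  As [G] is, some edge [xy] joins two
components of [H].  Then each triangle on [xy] has an edge in [X], and by
counting each edge of [X] completes exactly one of exactly [k] triangles
([spoiled_edge]).  Let [xyz] be one of them, with [xz] in [X] say; then [yz]
joins two components as well.  Comparing what [xy] and [yz] say on [X], and
using [max_trail] on a quadrilateral, gives [X = {xz}] ([cross_single]).  Each
vertex other than [x], [y], [z] is then adjacent either to [y] only or to [x]
and [z] only; counting degrees shows that the first kind does not occur
([cross_structure]), so that [x] and [z] are adjacent to all other vertices.

If two of these other vertices, [a] and [b], are adjacent, then exchanging
[xaz] for [xyz] in [H] leaves an even set that is connected, [a] being still
attached through [b] ([cross_reroute]).  Otherwise [G] is [K2star (n - 2)], and
[n] is even because for odd [n] the set of all edges is even, and by maximality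
equal to [H], which does not contain [xy] ([cross_K2star]). *)

Set Implicit Arguments.
Unset Strict Implicit.
Unset Printing Implicit Defensive.

(** * Walks and sets of edges of even degree *)

Section Walks.

Variable T : finType.
Implicit Types (u v w x y z : T) (p : seq T) (E : {set T}) (A B C H : {set {set T}}).

Lemma eq_set2 u v x y :
  ([set u; v] == [set x; y]) = (u == x) && (v == y) || (u == y) && (v == x).
Proof.
apply/eqP/idP => [eqE | /orP[]/andP[/eqP-> /eqP->] //]; last exact: setUC.
have: u \in [set x; y] by rewrite -eqE !inE eqxx.
have: v \in [set x; y] by rewrite -eqE !inE eqxx orbT.
have: x \in [set u; v] by rewrite eqE !inE eqxx.
have: y \in [set u; v] by rewrite eqE !inE eqxx orbT.
rewrite !inE (eq_sym x) (eq_sym x v) (eq_sym y) (eq_sym y v).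
by case: (u == x); case: (v == y); case: (u == y); case: (v == x).
Qed.

Lemma walk_edges_cat x p q :
  walk_edges x (p ++ q) = walk_edges x p ++ walk_edges (last x p) q.
Proof. exact: pairmap_cat. Qed.

Lemma mem_walk_edges x p E v : E \in walk_edges x p -> v \in E -> v \in x :: p.
Proof.
elim: p x => [|y p IHp] x //=; rewrite in_cons => /predU1P[-> | /IHp in_p /in_p].
  by rewrite !inE => /orP[]->; rewrite ?orbT.
by move=> v_yp; rewrite in_cons v_yp orbT.
Qed.

(** Each visit of a walk to a vertex uses two incidences with it, except at the
two ends. *)
Lemma odd_count_walk (e : rel T) x p v : irreflexive e -> path e x p ->
  odd (count (fun E => v \in E) (walk_edges x p)) = (v == x) (+) (v == last x p).
Proof.
move=> irr_e; elim: p x => [|y p IHp] x /=; first by rewrite addbb.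
case/andP=> e_xy /IHp; rewrite oddD => ->; rewrite !inE.
have: x != y by apply: contraTneq e_xy => ->; rewrite irr_e.
by case: (eqVneq v x) => [-> /negPf-> | _] //= _; case: (v == y); case: (v == _).
Qed.

Definition incident H v := [set E in H | v \in E].

Definition even_set H := [forall v, ~~ odd #|incident H v|].

Definition adj H : rel T := fun u v => [set u; v] \in H.

Lemma adj_sym H : symmetric (adj H).
Proof. by move=> u v; rewrite /adj setUC. Qed.

Lemma conn_sym H : connect_sym (adj H).
Proof. exact: (sym_connect_sym (@adj_sym H)). Qed.

Lemma path_adj H x p : path (adj H) x p = all (mem H) (walk_edges x p).
Proof. by elim: p x => //= y p IHp x; rewrite IHp. Qed.

Lemma card_set_seq (s : seq {set T}) (P : pred {set T}) :
  uniq s -> #|[set E in s | P E]| = count P s.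
Proof.
move=> Us; rewrite -size_filter -(card_uniqP (filter_uniq P Us)).
by apply: eq_card => E; rewrite inE mem_filter andbC.
Qed.

Lemma even_closed_trail (e : rel T) x p : irreflexive e -> closed_trail e x p ->
  even_set [set E in walk_edges x p].
Proof.
move=> irr_e /and3P[e_p /eqP last_p Up]; apply/forallP=> v.
have -> : incident [set E in walk_edges x p] v = [set E in walk_edges x p | v \in E].
  by apply/setP=> E; rewrite !inE.
by rewrite card_set_seq // (odd_count_walk _ irr_e e_p) last_p addbb.
Qed.

Definition symdiff A B := (A :\: B) :|: (B :\: A).

Lemma in_symdiff A B E : (E \in symdiff A B) = (E \in A) (+) (E \in B).
Proof. by rewrite !inE; case: (E \in A); case: (E \in B). Qed.

Lemma card_symdiff A B : #|symdiff A B| + #|A :&: B|.*2 = #|A| + #|B|.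
Proof.
have := cardsID B A; have := cardsID A B; rewrite (setIC B A).
have -> : #|symdiff A B| = #|A :\: B| + #|B :\: A|.
  rewrite -cardsUI; suff ->: (A :\: B) :&: (B :\: A) = set0 by rewrite cards0 addn0.
  by apply/setP=> E; rewrite !inE; case: (E \in A); case: (E \in B).
lia.
Qed.

Lemma even_symdiff A B : even_set A -> even_set B -> even_set (symdiff A B).
Proof.
move=> /forallP evA /forallP evB; apply/forallP=> v.
have -> : incident (symdiff A B) v = symdiff (incident A v) (incident B v).
  apply/setP=> E; rewrite [in RHS]in_symdiff /incident !inE.
  by case: (v \in E); rewrite ?andbT ?andbF //; case: (E \in A); case: (E \in B).
have := card_symdiff (incident A v) (incident B v); move: (evA v) (evB v); lia.
Qed.

End Walks.

(** * Closed trails in a simple graph *)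

Section Graph.

Variables (T : finType) (e : rel T).
Hypotheses (sym_e : symmetric e) (irr_e : irreflexive e).
Implicit Types (u v w x y z : T) (p : seq T) (E : {set T}) (H : {set {set T}}).

Lemma mem_edges x y : ([set x; y] \in edges e) = e x y.
Proof.
apply/imsetP/idP => [[[u v]] | e_xy]; last by exists (x, y); rewrite ?inE.
rewrite inE /= => e_uv /eqP; rewrite eq_set2.
by case/orP=> /andP[/eqP-> /eqP->] //; rewrite sym_e.
Qed.

Lemma edge_neq x y : e x y -> x != y.
Proof. by apply: contraTneq => ->; rewrite irr_e. Qed.

Lemma sub_adj H : H \subset edges e -> subrel (adj H) e.
Proof. by move=> sHe u v /(subsetP sHe); rewrite mem_edges. Qed.

Definition trail H x p := path (adj H) x p && uniq (walk_edges x p).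

Lemma size_walk_edges x p : size (walk_edges x p) = size p.
Proof. exact: size_pairmap. Qed.

Lemma trail_size H x p : trail H x p -> size p <= #|H|.
Proof.
case/andP; rewrite path_adj => /allP sH /card_uniqP.
by rewrite size_walk_edges => <-; apply/subset_leq_card/subsetP.
Qed.

Lemma trail_rot H x p q : last x (p ++ q) = x ->
  trail H x (p ++ q) = trail H (last x p) (q ++ p).
Proof.
rewrite last_cat => closed_pq; rewrite /trail !path_adj !walk_edges_cat closed_pq.
by rewrite !all_cat uniq_catC [all _ _ && all _ _]andbC.
Qed.

(** Euler's theorem.  A longest trail of [H] cannot be extended, hence by parity
is closed; being closed it can be started at any of its vertices, so it uses all
the edges of [H] at each vertex that it meets, and connectivity makes it meet
all vertices. *)
Lemma euler H : H \subset edges e -> even_set H ->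
    (forall x y, connect (adj H) x y) -> 0 < #|T| ->
  exists x p, [/\ closed_trail e x p, spanning x p
                & forall E, E \in H -> E \in walk_edges x p].
Proof.
move=> sHe /forallP evH connH /card_gt0P[x0 _].
pose has_trail m := [exists x, exists p : m.-tuple T, trail H x p].
have has_trail0 : exists m, has_trail m.
  by exists 0; apply/existsP; exists x0; apply/existsP; exists [tuple].
have trail_bound m : has_trail m -> m <= #|H|.
  by case/existsP=> x /existsP[p /trail_size]; rewrite size_tuple.
case: (ex_maxnP has_trail0 trail_bound) => m /existsP[x /existsP[[p /= size_p] Hp]] max_m.
have saturated y q w : trail H y q -> size q = m -> adj H (last y q) w ->
    [set last y q; w] \in walk_edges y q.
  move=> /andP[Hq Uq] size_q Hw; apply/contraT=> new_w.
  suff /max_m : has_trail m.+1 by rewrite ltnn.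
  apply/existsP; exists y; apply/existsP.
  have sz : size (rcons q w) == m.+1 by rewrite size_rcons size_q.
  exists (Tuple sz); rewrite /trail /= rcons_path Hq Hw /=.
  by rewrite -cats1 walk_edges_cat cat_uniq Uq /= orbF new_w.
have {}size_p := eqP size_p.
have [path_p Up] := andP Hp.
have e_p : path e x p by apply: sub_path path_p; apply: sub_adj.
(* The unused edges at the end of an open trail would be odd in number. *)
have closed_p : last x p = x.
  set y := last x p; apply/eqP.
  have := odd_count_walk y irr_e e_p; rewrite -/y eqxx -(card_set_seq _ Up).
  suff -> : [set E in walk_edges x p | y \in E] = incident H y.
    by rewrite (negPf (evH y)); case: (y == x).
  apply/setP=> E; rewrite !inE.
  case yE: (y \in E); rewrite ?andbF ?andbT //; apply/idP/idP.
    by move: path_p; rewrite path_adj => /allP; apply.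
  move=> HE; have /imsetP[[u v] _ /= defE] := subsetP sHe E HE.
  have [w defEw] : exists w, E = [set y; w].
    move: yE; rewrite defE !inE => /orP[]/eqP->; first by exists v.
    by exists u; rewrite setUC.
  by rewrite defEw; apply: saturated; rewrite // /adj -defEw.
(* Rotating the trail to start at [v] gives another longest trail. *)
have sat_p v w : v \in x :: p -> adj H v w -> [set v; w] \in walk_edges x p.
  move=> v_p; case/splitPl: v_p path_p Up size_p closed_p Hp => p1 p2 <-.
  move=> _ _ size_p closed_p Hp Hvw; rewrite trail_rot // in Hp.
  have last_v : last (last x p1) (p2 ++ p1) = last x p1.
    by rewrite last_cat -(last_cat x) closed_p.
  have := saturated _ _ w Hp; rewrite last_v => /(_ _ Hvw).
  rewrite !walk_edges_cat -(last_cat x) closed_p !mem_cat orbC; apply.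
  by rewrite size_cat addnC -size_cat.
have span_p : spanning x p.
  move=> v; have /connectP[q Hq ->] := connH x v.
  have: x \in x :: p by rewrite mem_head.
  elim: q {1 2 4}x Hq => //= w q IHq y /andP[Hyw Hq] y_p; apply: IHq => //.
  by apply: mem_walk_edges (sat_p _ _ y_p Hyw) _; rewrite !inE eqxx orbT.
exists x, p; split=> //; first by rewrite /closed_trail e_p Up closed_p eqxx.
move=> E HE; have /imsetP[[u v] _ /= defE] := subsetP sHe E HE.
by rewrite defE; apply: sat_p; rewrite ?span_p // /adj -defE.
Qed.

Lemma cycle_trail x p : uniq (x :: p) -> path e x p -> e (last x p) x ->
  1 < size p -> closed_trail e x (rcons p x).
Proof.
have Uwalk y q : uniq (y :: q) -> uniq (walk_edges y q).
  elim: q y => //= z q IHq y /andP[y_notin Uzq]; rewrite [uniq _]IHq // andbT.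
  by apply: contra y_notin => /mem_walk_edges; apply; rewrite !inE eqxx.
move=> Uxp e_p e_last size_p; rewrite /closed_trail rcons_path e_p e_last last_rcons eqxx.
rewrite -cats1 walk_edges_cat cat_uniq Uwalk //= orbF andbT.
case: p Uxp size_p {e_p e_last} => [|y [|z p]] // /andP[x_notin /andP[y_notin _]] _.
rewrite [_ \in _]in_cons negb_or eq_set2 negb_or; apply/andP; split.
  rewrite !negb_and orbC /=; apply/andP; split; apply/orP.
    by right; apply: contraNneq x_notin => <-; rewrite inE mem_last orbT.
  by left; apply: contraNneq y_notin => <-; rewrite mem_last.
apply: contra x_notin => in_p; apply: (@mem_walk_edges _ y (z :: p)) in_p _.
by rewrite !inE eqxx orbT.
Qed.

Lemma card_incident_edges v : #|incident (edges e) v| = degree e v.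
Proof.
rewrite /degree -(card_in_imset (f := fun w => [set v; w])) => [|w w' _ _ /eqP]; last first.
  by rewrite eq_set2 eqxx => /orP[/eqP// | /andP[/eqP-> /eqP->]].
apply: eq_card => E; rewrite inE; apply/andP/imsetP => [[] | [w]]; last first.
  by rewrite inE => e_vw ->; rewrite mem_edges !inE eqxx.
case/imsetP=> [[a b]]; rewrite inE /= => e_ab ->; rewrite !inE.
case/orP=> /eqP->; first by exists b; rewrite ?inE.
by exists a; [rewrite inE sym_e | rewrite setUC].
Qed.

(** * Recognizing the exceptional graph *)

Lemma isomorphic_K2star x z : e x z ->
    (forall v, v != x -> v != z -> e x v && e z v) ->
    (forall u v, u != x -> u != z -> v != x -> v != z -> ~~ e u v) ->
  isomorphic e (@K2star (#|T| - 2)).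
Proof.
move=> e_xz full indep; have x'z := edge_neq e_xz.
pose S := ~: [set x; z].
have cardS : #|S| = #|T| - 2 by rewrite -(cardsC [set x; z]) cards2 x'z addKn.
have inS v : v != x -> v != z -> v \in S by rewrite !inE negb_or => -> ->.
(* The values [inl ord0] at [x] and [inl ord_max] at [z] match [K2star]; the
   default [None] branch is never reached. *)
pose f v : 'I_2 + 'I_(#|T| - 2) :=
  if v == x then inl ord0 else if v == z then inl ord_max else
  match insub (index v (enum S)) with Some i => inr i | None => inl ord0 end.
have fx : f x = inl ord0 by rewrite /f eqxx.
have fz : f z = inl ord_max by rewrite /f eq_sym (negPf x'z) eqxx.
have fS v : v != x -> v != z -> exists2 i, f v = inr i & val i = index v (enum S).
  move=> v'x v'z; rewrite /f (negPf v'x) (negPf v'z).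
  have lt_v : index v (enum S) < #|T| - 2.
    by rewrite -cardS cardE index_mem mem_enum inS.
  by rewrite insubT; exists (Ordinal lt_v).
exists f.
  apply: inj_card_bij => [u v|]; last first.
    by rewrite card_sum !card_ord -cardS -(cardsC [set x; z]) cards2 x'z.
  have [->|u'x] := eqVneq u x; last have [->|u'z] := eqVneq u z;
    (have [->|v'x] := eqVneq v x; last have [->|v'z] := eqVneq v z);
    rewrite ?fx ?fz //.
  - by have [i -> _] := fS v v'x v'z.
  - by have [i -> _] := fS v v'x v'z.
  - by have [i -> _] := fS u u'x u'z.
  - by have [i -> _] := fS u u'x u'z.
  have [i -> defi] := fS u u'x u'z; have [j -> defj] := fS v v'x v'z => -[eq_ij].
  rewrite -(nth_index x (s := enum S) (x := u)) ?mem_enum ?inS // -defi eq_ij defj.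
  by rewrite nth_index ?mem_enum ?inS.
move=> u v; rewrite /K2star /add_edge !eq_set2.
have [->|u'x] := eqVneq u x; have [->|v'x] := eqVneq v x.
- by rewrite fx irr_e.
- rewrite fx; have [->|v'z] := eqVneq v z; first by rewrite fz.
  by have [i -> _] := fS v v'x v'z; have /andP[-> _] := full v v'x v'z.
- rewrite fx; have [->|u'z] := eqVneq u z; first by rewrite fz sym_e.
  by have [i -> _] := fS u u'x u'z; have /andP[+ _] := full u u'x u'z; rewrite sym_e => ->.
have [->|u'z] := eqVneq u z; have [->|v'z] := eqVneq v z.
- by rewrite fz irr_e.
- by rewrite fz; have [i -> _] := fS v v'x v'z; have /andP[_ ->] := full v v'x v'z.
- rewrite fz; have [i -> _] := fS u u'x u'z.
  by have /andP[_ +] := full u u'x u'z; rewrite sym_e => ->.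
have [i -> _] := fS u u'x u'z; have [j -> _] := fS v v'x v'z.
by rewrite (negPf (indep u v _ _ _ _)).
Qed.

End Graph.

(** * Triangles on an edge *)

Section Extremal.

Variables (T : finType) (e : rel T) (k : nat) (X : {set {set T}}).
Hypotheses (sym_e : symmetric e) (irr_e : irreflexive e) (k_gt0 : 0 < k).
Hypotheses (sXe : X \subset edges e) (cardX : #|X| <= k).
Hypothesis deg_e : forall x y, e x y -> #|T| + k <= degree e x + degree e y.
Implicit Types (u v w x y z : T) (p : seq T) (E : {set T}) (H : {set {set T}}).

Let nb x := [set y | e x y].

Lemma card_common x y : e x y ->
  k <= #|nb x :&: nb y| /\ (#|nb x :&: nb y| <= k -> nb x :|: nb y = setT).
Proof.
move=> /deg_e; rewrite /degree -/(nb x) -/(nb y) -cardsUI => le_nk.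
have leU : #|nb x :|: nb y| <= #|T| by apply: max_card.
split=> [|le_k]; first by lia.
by apply/eqP; rewrite eqEcard subsetT cardsT; lia.
Qed.

(** The triangle [xyz] is of no use for changing a set of edges that must keep
containing [X] as soon as one of [xz] and [yz] is in [X]. *)
Definition spoiled x y :=
  forall z, e x z -> e y z -> ([set x; z] \in X) || ([set y; z] \in X).

(** Choosing an edge of [X] in each triangle on [xy] is an injection from the at
least [k] common neighbours of [x] and [y] into the at most [k] edges of [X]
other than [xy]; it is therefore onto [X], and all the inequalities involved
are equalities. *)
Lemma spoiled_edge x y : e x y -> spoiled x y ->
  [/\ [set x; y] \notin X, nb x :|: nb y = setT, exists2 z, e x z & e y z
    & forall E, E \in X ->
      exists z, [/\ e x z, e y z & E = [set x; z] \/ E = [set y; z]]].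
Proof.
move=> e_xy spoil; have x'y := edge_neq irr_e e_xy.
have [le_k fullU] := card_common e_xy.
pose f z := if [set x; z] \in X then [set x; z] else [set y; z].
pose Z := nb x :&: nb y.
have ZP z : z \in Z -> [/\ e x z, e y z, x != z & y != z].
  by rewrite !inE => /andP[e_xz e_yz]; split; rewrite // (edge_neq irr_e).
have fX : f @: Z \subset X.
  apply/subsetP=> _ /imsetP[z /ZP[e_xz e_yz _ _] ->].
  by rewrite /f; case: ifP (spoil z e_xz e_yz).
have cardf : #|f @: Z| = #|Z|.
  apply: card_in_imset => z w /ZP[_ _ /negPf x'z /negPf y'z] /ZP[_ _ /negPf x'w /negPf y'w].
  by rewrite /f; case: ifP => _; case: ifP => _ /eqP; rewrite eq_set2
    ?eqxx ?x'w ?y'w ?(negPf x'y) ?(eq_sym y x) ?(negPf x'y) //= ?orbF => /eqP.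
have eqX : X = f @: Z by apply/eqP; rewrite eq_sym eqEcard fX cardf (leq_trans cardX).
split.
- rewrite eqX; apply/imsetP=> [[z /ZP[_ _ /negPf x'z /negPf y'z]]] /eqP.
  by rewrite /f; case: ifP => _; rewrite eq_set2 ?(eq_sym y x) (negPf x'y) ?x'z ?y'z ?eqxx ?andbF.
- by apply: fullU; rewrite -/Z -cardf -eqX.
- have /card_gt0P[z /ZP[]] : 0 < #|Z| by apply: leq_trans le_k.
  by exists z.
move=> E; rewrite {1}eqX => /imsetP[z /ZP[e_xz e_yz _ _] ->]; exists z; split=> //.
by rewrite /f; case: ifP; [left | right].
Qed.

Lemma triangle_trail x y z : e x y -> e y z -> e z x -> closed_trail e x [:: y; z; x].
Proof.
move=> e_xy e_yz e_zx; rewrite -[[:: y; z; x]]/(rcons [:: y; z] x); apply: cycle_trail => //=; last first.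
  by rewrite e_xy e_yz.
by rewrite !inE !negb_or (edge_neq irr_e e_xy) (edge_neq irr_e e_yz) eq_sym (edge_neq irr_e e_zx).
Qed.

Lemma symdiff_sub H x p : H \subset edges e -> closed_trail e x p ->
  symdiff H [set E in walk_edges x p] \subset edges e.
Proof.
move=> sHe /and3P[e_p _ _]; have sp : [set E in walk_edges x p] \subset edges e.
  apply/subsetP=> E; rewrite inE; elim: p x e_p => //= y p IHp x /andP[e_xy /IHp sub_p].
  by rewrite in_cons => /predU1P[->|//]; rewrite mem_edges.
apply/subsetP=> E; rewrite in_symdiff.
case: (boolP (E \in H)) => [/(subsetP sHe)//|_ Ep]; exact: (subsetP sp).
Qed.

(** Among the even sets take one that contains as many edges of [X] as possible.
An edge of [X] outside it could be added by means of a triangle whose two other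
edges are not in [X]; [spoiled_edge] provides the triangle. *)
Lemma even_cover : exists H, [/\ H \subset edges e, even_set H & X \subset H].
Proof.
pose P H := (H \subset edges e) && even_set H.
have P0 : P set0.
  rewrite /P sub0set; apply/forallP=> v; suff -> : incident set0 v = set0 by rewrite cards0.
  by apply/setP=> E; rewrite !inE.
case: (arg_maxnP (fun H => #|H :&: X|) P0) => H /andP[sHe evH] maxH.
exists H; split=> //; apply/subsetP=> E EX; apply/contraT=> HE.
have /imsetP[[x y]] := subsetP sXe E EX; rewrite inE /= => e_xy defE.
have [z e_xz e_yz] : exists2 z, e x z & e y z && ([set x; z] \notin X) && ([set y; z] \notin X).
  apply/exists_inP/contraT; rewrite negb_exists_in => /forall_inP no_z.
  case: (spoiled_edge e_xy) => [z e_xz e_yz|]; last by rewrite -defE EX.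
  by have := no_z z e_xz; rewrite e_yz /= negb_and !negbK.
have {e_yz} /andP[/andP[e_yz xzX] yzX] := e_yz.
have tri : closed_trail e x [:: y; z; x] by apply: triangle_trail; rewrite // sym_e.
have : P (symdiff H [set E in walk_edges x [:: y; z; x]]).
  by rewrite /P symdiff_sub //= even_symdiff // (even_closed_trail irr_e tri).
move/maxH; suff -> : symdiff H [set E in walk_edges x [:: y; z; x]] :&: X = E |: (H :&: X).
  by rewrite cardsU1 !inE (negPf HE) /= add1n ltnn.
apply/setP=> F; rewrite in_setI in_symdiff !inE -defE.
have [->|_] := eqVneq F E; first by rewrite EX (negPf HE).
case FX: (F \in X); rewrite ?andbF // !andbT.
have [Fyz|_] := eqVneq F [set y; z]; first by rewrite Fyz (negPf yzX) in FX.
have [Fxz|_] := eqVneq F [set z; x]; first by rewrite Fxz setUC (negPf xzX) in FX.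
by rewrite addbF.
Qed.

(** * A largest even set containing the prescribed edges *)

Section Maximal.

Variable H : {set {set T}}.
Hypotheses (sHe : H \subset edges e) (evH : even_set H) (sXH : X \subset H).
Hypothesis maxH : forall H', H' \subset edges e -> even_set H' -> X \subset H' ->
  #|H'| <= #|H|.

Notation conn := (connect (adj H)).

(** Otherwise the symmetric difference with the trail would be larger than [H]. *)
Lemma max_trail x p : closed_trail e x p -> {in walk_edges x p, forall E, E \notin X} ->
  size p <= (count (mem H) (walk_edges x p)).*2.
Proof.
move=> tr_p notX; have [_ _ Up] := and3P tr_p.
pose C : {set {set T}} := [set E in walk_edges x p].
have /maxH : symdiff H C \subset edges e by apply: symdiff_sub.
have -> : even_set (symdiff H C) by rewrite even_symdiff // (even_closed_trail irr_e tr_p).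
have -> : X \subset symdiff H C.
  apply/subsetP=> E EX; rewrite in_symdiff (subsetP sXH) // inE.
  by apply/negP=> /notX; rewrite EX.
have <- : #|H :&: C| = count (mem H) (walk_edges x p).
  by rewrite -card_set_seq //; apply: eq_card => E; rewrite !inE andbC.
have -> : size p = #|C| by rewrite cardsE (card_uniqP Up) size_walk_edges.
by move=> /(_ isT isT) le_H; rewrite -(leq_add2l #|H|) -(card_symdiff H C) leq_add2r.
Qed.

Lemma connC u v : conn u v = conn v u.
Proof. exact: conn_sym. Qed.

Lemma cross_notin x y : ~~ conn x y -> [set x; y] \notin H.
Proof. by apply: contra => Hxy; apply: connect1. Qed.

(** [H] contains two sides of a triangle that avoids [X], hence connects its
vertices. *)
Lemma cross_spoiled x y : e x y -> ~~ conn x y -> spoiled x y.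
Proof.
move=> e_xy xCy z e_xz e_yz; apply: contraNT xCy; rewrite negb_or => /andP[xzX yzX].
case xyX: ([set x; y] \in X); first by apply: connect1; apply: (subsetP sXH).
have tri : closed_trail e x [:: y; z; x] by apply: triangle_trail; rewrite // sym_e.
have /(max_trail tri) : {in walk_edges x [:: y; z; x], forall E, E \notin X}.
  by move=> E; rewrite !inE => /or3P[]/eqP->; rewrite ?xyX // setUC.
rewrite /=.
case xyH: ([set x; y] \in H); first by move=> _; apply: connect1.
case yzH: ([set y; z] \in H); case zxH: ([set z; x] \in H) => // _.
by apply: (@connect_trans _ _ z); rewrite connect1 // adj_sym.
Qed.

Lemma cross_meets x y : e x y -> ~~ conn x y ->
  forall E, E \in X -> (x \in E) || (y \in E).
Proof.
move=> e_xy xCy E EX; have [_ _ _] := spoiled_edge e_xy (cross_spoiled e_xy xCy).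
by case/(_ E EX) => z [_ _ [] ->]; rewrite !inE eqxx ?orbT.
Qed.

(** If [x] and [z] were in one component and [y] and [w] in another, then the
quadrilateral [xyzw] would avoid [H], and could be added to it. *)
Lemma no_cross4 x y z w : e x y -> e y z -> e z w -> e w x ->
  conn x z -> conn y w -> x != z -> y != w -> conn x y.
Proof.
move=> e_xy e_yz e_zw e_wx xCz yCw x'z y'w; apply: contraT => xCy.
have CC a b : conn x a -> conn y b -> ~~ conn a b.
  move=> xCa yCb; apply: contra xCy => aCb; apply: connect_trans xCa _.
  by apply: connect_trans aCb _; rewrite connC.
have out : {in walk_edges x [:: y; z; w; x], forall E, E \notin H}.
  have x0 := connect0 (adj H) x; have y0 := connect0 (adj H) y.
  by move=> E; rewrite !inE => /or4P[]/eqP->; rewrite 1?[[set y; z]]setUC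
    1?[[set w; x]]setUC cross_notin // CC.
have tr : closed_trail e x (rcons [:: y; z; w] x).
  apply: cycle_trail => //=; last by rewrite e_xy e_yz e_zw.
  rewrite !inE !negb_or (edge_neq irr_e e_xy) x'z (eq_sym x) (edge_neq irr_e e_wx).
  by rewrite (edge_neq irr_e e_yz) y'w (edge_neq irr_e e_zw).
have /(max_trail tr) : {in walk_edges x [:: y; z; w; x], forall E, E \notin X}.
  by move=> E /out; apply: contra; apply: (subsetP sXH).
by rewrite (@eq_in_count _ _ pred0) ?count_pred0 // => E /out/negPf.
Qed.

Lemma conn_X x z : [set x; z] \in X -> conn x z.
Proof. by move=> xzX; apply: connect1; apply: (subsetP sXH). Qed.

(** * An edge between two components *)

Section Crossing.

Variables x y z : T.
Hypotheses (e_xy : e x y) (xCy : ~~ conn x y) (e_xz : e x z) (e_yz : e y z).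
Hypothesis xzX : [set x; z] \in X.

Let xCz : conn x z. Proof. exact: conn_X. Qed.

Let yCz : ~~ conn y z.
Proof. by apply: contra xCy => yCz; rewrite (connect_trans xCz) // connC. Qed.

Let x'y : (x == y) = false.
Proof. by rewrite (negPf (edge_neq irr_e e_xy)). Qed.
Let x'z : (x == z) = false.
Proof. by rewrite (negPf (edge_neq irr_e e_xz)). Qed.
Let y'z : (y == z) = false.
Proof. by rewrite (negPf (edge_neq irr_e e_yz)). Qed.

(** By [spoiled_edge] for the crossing edges [xy] and [yz], an edge of [X] other
than [xz] joins [y] to a vertex [w] that is adjacent to both [x] and [z]; but
then all sides of [xyzw] cross, against [no_cross4]. *)
Lemma cross_single : X = [set [set x; z]].
Proof.
apply/eqP; rewrite eqEsubset sub1set xzX andbT; apply/subsetP=> E EX; rewrite inE.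
have [_ _ _] := spoiled_edge e_xy (cross_spoiled e_xy xCy).
case/(_ E EX) => w [e_xw e_yw [defE|defE]]; rewrite defE in EX *.
  have := cross_meets e_yz yCz EX; rewrite !inE.
  rewrite (eq_sym y) (negPf (edge_neq irr_e e_xy)) (negPf (edge_neq irr_e e_yw)) /=.
  by rewrite (eq_sym z) (negPf (edge_neq irr_e e_xz)) => /= /eqP->.
have [_ _ _] := spoiled_edge e_yz (cross_spoiled e_yz yCz).
case/(_ _ EX) => w' [e_yw' e_zw' [] /eqP]; rewrite eq_set2; last first.
  by rewrite (negPf (edge_neq irr_e e_yz)) (negPf (edge_neq irr_e e_yw')).
rewrite eqxx /= => /orP[/eqP eq_w|/andP[/eqP yw']]; last by rewrite -yw' irr_e in e_yw'.
rewrite -eq_w in e_zw'; case/negP: xCy.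
apply: (@no_cross4 x y z w) => //; first by rewrite sym_e.
- exact: conn_X.
- exact: edge_neq e_xz.
exact: edge_neq e_yw.
Qed.

(** Let [B] be the set of neighbours of [y] other than [x] and [z].  For [v] in
[B], no edge [yv] or [vw] crosses, because it does not meet [xz]; so if a
neighbour [w] of [v] were adjacent to [x] and [z] instead of [y], then [xyzw]
would contradict [no_cross4].  Hence all neighbours of [v] except [y] are in
[B], [d(v) <= d(y) - 2], and [d(v) + d(y) > n] gives [2 d(y) > n + 2].  On the
other hand [x] and [y], and likewise [y] and [z], have a single common neighbour
and together reach all vertices, so [d(x) + d(y) = d(y) + d(z) = n + 1]; with
[d(x) + d(z) > n] this gives [2 d(y) <= n + 1].  Therefore [B] is empty. *)
Lemma cross_structure v : v != x -> v != y -> v != z -> [&& e x v, e z v & ~~ e y v].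
Proof.
have defX := cross_single.
have [_ full_xy _ _] := spoiled_edge e_xy (cross_spoiled e_xy xCy).
have [_ full_yz _ _] := spoiled_edge e_yz (cross_spoiled e_yz yCz).
have common_xy : nb x :&: nb y = [set z].
  apply/setP=> w; rewrite !inE; apply/andP/eqP => [[e_xw e_yw]|->//].
  have /orP[] := cross_spoiled e_xy xCy e_xw e_yw; rewrite defX inE eq_set2.
    by rewrite eqxx x'z /= orbF => /eqP.
  by rewrite eq_sym x'y y'z.
have common_yz : nb y :&: nb z = [set x].
  apply/setP=> w; rewrite !inE; apply/andP/eqP => [[e_yw e_zw]|->]; last by rewrite !(sym_e _ x).
  have /orP[] := cross_spoiled e_yz yCz e_yw e_zw; rewrite defX inE eq_set2.
    by rewrite eq_sym x'y y'z.
  by rewrite eqxx eq_sym x'z => /eqP.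
have dichotomy w : w != x -> w != z -> (e x w = ~~ e y w) * (e z w = ~~ e y w).
  move=> /negPf w'x /negPf w'z; move/setP/(_ w): common_xy; move/setP/(_ w): common_yz.
  move/setP/(_ w): full_xy; move/setP/(_ w): full_yz; rewrite !inE w'x w'z.
  by case: (e x w); case: (e y w); case: (e z w).
move=> v'x _ v'z; suff no_B : ~~ e y v by rewrite !(dichotomy v v'x v'z) no_B.
apply/negP=> e_yv.
have good_conn a b : e a b -> a != x -> a != z -> b != x -> b != z -> conn a b.
  move=> e_ab /negPf a'x /negPf a'z /negPf b'x /negPf b'z; apply/contraT=> aCb.
  have := cross_meets e_ab aCb xzX.
  by rewrite !inE a'x a'z b'x b'z.
have y'x : y != x by rewrite eq_sym x'y.
have yCv : conn y v by apply: good_conn; rewrite ?y'z.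
have [e_xv e_zv] := dichotomy v v'x v'z; rewrite e_yv in e_xv e_zv.
have nb_v : nb v \subset y |: (((nb y :\ x) :\ z) :\ v).
  apply/subsetP=> w; rewrite !inE => e_vw; have [//|w'y] := eqVneq w y.
  have /negPf-> : w != v by rewrite eq_sym (edge_neq irr_e).
  have w'z : w != z by apply: contraFneq e_zv => <-; rewrite sym_e.
  have w'x : w != x by apply: contraFneq e_xv => <-; rewrite sym_e.
  rewrite w'z w'x /=; apply: contraT => e_yw; case/negP: xCy.
  have [e_xw e_zw] := dichotomy w w'x w'z; rewrite e_yw in e_xw e_zw.
  apply: (@no_cross4 x y z w) => //; rewrite 1?sym_e ?x'z 1?eq_sym //.
  by apply: connect_trans yCv (good_conn _ _ e_vw v'x v'z w'x w'z).
have := subset_leq_card nb_v; rewrite cardsU1.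
have := cardsD1 x (nb y); have := cardsD1 z (nb y :\ x); have := cardsD1 v (nb y :\ x :\ z).
rewrite !inE v'x v'z e_yv e_yz sym_e e_xy eq_sym x'z /=.
have := cardsUI (nb x) (nb y); rewrite full_xy common_xy cards1 cardsT.
have := cardsUI (nb y) (nb z); rewrite full_yz common_yz cards1 cardsT.
have := deg_e e_yv; have := deg_e e_xz; rewrite /degree -!/(nb _).
rewrite irr_e !andbF /=; move: #|nb y :\ x :\ z :\ v| #|nb y :\ x :\ z| #|nb y :\ x|.
by move: #|nb x| #|nb y| #|nb z| #|nb v| #|T|; clear - k_gt0; lia.
Qed.

Let dominating v : v != x -> v != z -> e x v && e z v.
Proof.
move=> v'x v'z; have [->|v'y] := eqVneq v y; first by rewrite e_xy sym_e.
by have /and3P[-> ->] := cross_structure v'x v'y v'z.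
Qed.

Let xyH : [set x; y] \notin H. Proof. exact: cross_notin. Qed.
Let yzH : [set y; z] \notin H. Proof. exact: cross_notin. Qed.

Let notin_X u v :
  ~~ (((u == x) && (v == z)) || ((u == z) && (v == x))) -> [set u; v] \notin X.
Proof. by rewrite cross_single inE eq_set2 (andbC (u == z)) (andbC (v == x)). Qed.

(** [H] contains neither of the first two sides of [xyzc], hence both of the
others. *)
Lemma spoke c :
  c != x -> c != z -> c != y -> ([set z; c] \in H) && ([set c; x] \in H).
Proof.
move=> c'x c'z c'y; have /andP[e_xc e_zc] := dominating c'x c'z.
have tr : closed_trail e x (rcons [:: y; z; c] x).
  apply: cycle_trail => //=; last by rewrite sym_e.
    by rewrite !inE !negb_or x'y x'z y'z !(eq_sym _ c) c'x c'y c'z.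
  by rewrite e_xy e_yz e_zc.
have /(max_trail tr) /= : {in walk_edges x (rcons [:: y; z; c] x), forall E, E \notin X}.
  move=> E; rewrite !inE => /or4P[]/eqP->; apply: notin_X;
  by rewrite ?(negPf c'x) ?(negPf c'z) ?y'z ?(eq_sym y x) ?(eq_sym z x) ?x'y ?x'z ?andbF.
by rewrite (negPf xyH) (negPf yzH); case: (_ \in H); case: (_ \in H).
Qed.

(** For odd [n] all degrees would be even, [n - 1] at [x] and [z] and 2
elsewhere, and the set of all edges would be larger than [H]. *)
Lemma cross_K2star :
    (forall u v, u != x -> u != z -> v != x -> v != z -> ~~ e u v) ->
  ~~ odd #|T| /\ isomorphic e (@K2star (#|T| - 2)).
Proof.
move=> indep.
split; last by apply: (@isomorphic_K2star _ _ sym_e irr_e x z).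
apply/negP=> odd_n.
have nb_hub c : (c == x) || (c == z) -> nb c = ~: [set c].
  move=> c_xz; apply/setP=> v; rewrite !inE; case: (eqVneq v c) => [->|]; first exact: irr_e.
  have [->|v'x] := eqVneq v x.
    by case/orP: c_xz => /eqP-> //; [rewrite eqxx | rewrite sym_e].
  have [->|v'z] := eqVneq v z; first by case/orP: c_xz => /eqP-> //; rewrite eqxx.
  by have /andP[e_xv e_zv] := dominating v'x v'z; case/orP: c_xz => /eqP->.
have nb_other c : c != x -> c != z -> nb c = [set x; z].
  move=> c'x c'z; apply/setP=> v; rewrite !inE.
  have /andP[e_xc e_zc] := dominating c'x c'z.
  have [->|v'x] := eqVneq v x; first by rewrite sym_e.
  have [->|v'z] := eqVneq v z; first by rewrite sym_e.
  by rewrite (negPf (indep c v _ _ _ _)).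
have : even_set (edges e).
  apply/forallP=> c; rewrite card_incident_edges // /degree -/(nb c).
  case c_xz: ((c == x) || (c == z)).
    by rewrite nb_hub //; move: odd_n; rewrite -(cardsC [set c]) cards1.
  by move/negbT: c_xz; rewrite negb_or => /andP[c'x c'z]; rewrite nb_other // cards2 x'z.
move/maxH=> /(_ (subxx _) sXe) le_e.
have eqH : H = edges e by apply/eqP; rewrite eqEcard sHe.
by case/negP: xCy; apply: connect1; rewrite /adj eqH mem_edges.
Qed.

(** Replacing the path [xaz] by [xyz] in [H] joins [y] to the rest; [a] is not
cut off, as [ab] is in [H]. *)
Lemma cross_reroute a b : a != x -> a != z -> b != x -> b != z -> e a b ->
  exists H', [/\ H' \subset edges e, even_set H', X \subset H'
    & forall u v, connect (adj H') u v].
Proof.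
move=> a'x a'z b'x b'z e_ab.
have a'y : a != y.
  apply: contraTneq e_ab => ->; have [->|b'y] := eqVneq b y; first by rewrite irr_e.
  by have /and3P[] := cross_structure b'x b'y b'z.
have b'y : b != y.
  by apply: contraTneq e_ab => ->; rewrite sym_e; have /and3P[] := cross_structure a'x a'y a'z.
have /negPf a'b := edge_neq irr_e e_ab.
have /andP[zaH axH] := spoke a'x a'z a'y; have /andP[_ bxH] := spoke b'x b'z b'y.
have /andP[e_xa e_za] := dominating a'x a'z; have /andP[e_xb _] := dominating b'x b'z.
(* Otherwise [xyzab] has only two of its five edges, [za] and [bx], in [H]. *)
have abH : [set a; b] \in H.
  have tr : closed_trail e x (rcons [:: y; z; a; b] x).
    apply: cycle_trail => //=; last by rewrite sym_e.
      by rewrite !inE !negb_or x'y x'z y'z !(eq_sym _ a) !(eq_sym _ b)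
        (eq_sym b a) a'x a'y a'z b'x b'y b'z a'b.
    by rewrite e_xy e_yz e_za e_ab.
  have /(max_trail tr) /= : {in walk_edges x (rcons [:: y; z; a; b] x), forall E, E \notin X}.
    move=> E; rewrite !inE => /or4P[|||/orP[]]/eqP->; apply: notin_X;
    by rewrite ?(negPf a'x) ?(negPf a'z) ?(negPf b'x) ?(negPf b'z) ?y'z ?(eq_sym y x) ?(eq_sym z x) ?x'y ?x'z ?andbF.
  by rewrite (negPf xyH) (negPf yzH) zaH bxH; case: (_ \in H).
pose C : {set {set T}} := [set E in walk_edges x [:: y; z; a; x]].
have tr : closed_trail e x (rcons [:: y; z; a] x).
  apply: cycle_trail => //=; last by rewrite sym_e.
    by rewrite !inE !negb_or x'y x'z y'z !(eq_sym _ a) a'x a'y a'z.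
  by rewrite e_xy e_yz e_za.
have inC u v : ([set u; v] \in C) = [|| (u == x) && (v == y) || (u == y) && (v == x),
    (u == y) && (v == z) || (u == z) && (v == y),
    (u == z) && (v == a) || (u == a) && (v == z)
    | (u == a) && (v == x) || (u == x) && (v == a)].
  by rewrite !inE !eq_set2.
exists (symdiff H C); split.
- exact: (symdiff_sub sHe tr).
- exact: (even_symdiff evH (even_closed_trail irr_e tr)).
- apply/subsetP=> E EX; rewrite in_symdiff (subsetP sXH) //.
  move: EX; rewrite cross_single inE => /eqP->; rewrite inC.
  by rewrite !(eq_sym _ a) !(eq_sym z) (negPf a'x) (negPf a'z) eqxx x'y x'z y'z !andbF.
have to_x v : connect (adj (symdiff H C)) v x.
  have yCx : connect (adj (symdiff H C)) y x.
    apply: connect1; rewrite /adj in_symdiff inC !eqxx !orbT addbT.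
    by rewrite setUC.
  have [->|v'x] := eqVneq v x; first exact: connect0.
  have [->|v'y] := eqVneq v y; first exact: yCx.
  have [->|v'z] := eqVneq v z.
    apply: connect_trans yCx; apply: connect1; rewrite /adj in_symdiff inC !eqxx !orbT addbT.
    by rewrite setUC.
  have direct c : c != x -> c != y -> c != z -> c != a ->
      connect (adj (symdiff H C)) c x.
    move=> c'x c'y c'z c'a; apply: connect1; rewrite /adj in_symdiff inC.
    have /andP[_ ->] := spoke c'x c'z c'y.
    by rewrite (negPf c'x) (negPf c'y) (negPf c'z) (negPf c'a).
  have [->|v'a] := eqVneq v a; last exact: direct.
  apply: connect_trans (direct b _ _ _ _) => //; last by rewrite eq_sym a'b.
  apply: connect1; rewrite /adj in_symdiff abH inC.
  by rewrite (negPf a'x) (negPf a'y) (negPf a'z) (negPf b'x) (negPf b'z) !andbF.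
by move=> u v; apply: connect_trans (to_x u) _; rewrite conn_sym.
Qed.

Lemma cross_conclusion :
  (exists H', [/\ H' \subset edges e, even_set H', X \subset H'
     & forall u v, connect (adj H') u v])
  \/ (~~ odd #|T| /\ isomorphic e (@K2star (#|T| - 2))).
Proof.
case: (boolP [exists a, exists b, [&& a != x, a != z, b != x, b != z & e a b]]).
  case/existsP=> a /existsP[b /and5P[a'x a'z b'x b'z e_ab]]; left.
  exact: cross_reroute e_ab.
move=> /existsPn no_ab; right; apply: cross_K2star => u v u'x u'z v'x v'z.
by have /existsPn/(_ v) := no_ab u; rewrite u'x u'z v'x v'z.
Qed.

End Crossing.

End Maximal.

(** * Spanning closed trails through prescribed edges *)

Lemma connected_even_cover : (forall x y, connect e x y) ->
  (exists H, [/\ H \subset edges e, even_set H, X \subset H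
     & forall u v, connect (adj H) u v])
  \/ (~~ odd #|T| /\ isomorphic e (@K2star (#|T| - 2))).
Proof.
move=> conn_e; have [H0 [sH0e evH0 sXH0]] := even_cover.
pose P H := [&& H \subset edges e, even_set H & X \subset H].
have P0 : P H0 by apply/and3P.
case: (arg_maxnP (fun H => #|H|) P0) => H /and3P[sHe evH sXH] maxP.
have maxH H' : H' \subset edges e -> even_set H' -> X \subset H' -> #|H'| <= #|H|.
  by move=> ? ? ?; apply: maxP; apply/and3P.
case: (boolP [exists x, exists y, e x y && ~~ connect (adj H) x y]); last first.
  move=> no_cross; left; exists H; split=> // u v.
  apply: (connect_sub _ (conn_e u v)) => x y e_xy.
  move/existsPn/(_ x)/existsPn/(_ y): no_cross.
  by rewrite e_xy negbK.
case/existsP=> x /existsP[y /andP[e_xy xCy]].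
have spoil := cross_spoiled sHe evH sXH maxH e_xy xCy.
have [_ _ [z e_xz e_yz] _] := spoiled_edge e_xy spoil.
(* The edge in [X] is [xz] or [yz]; the two cases differ by exchanging [x] and [y]. *)
case/orP: (spoil z e_xz e_yz) => zX.
  exact: (cross_conclusion sHe evH sXH maxH e_xy xCy e_xz e_yz).
apply: (cross_conclusion sHe evH sXH maxH _ _ e_yz e_xz zX); first by rewrite sym_e.
by rewrite conn_sym.
Qed.

End Extremal.

Theorem theorem7 (T : finType) (e : rel T) (n k : nat) (X : {set {set T}})
    (hG : simple_graph e) (hconn : connected_graph e) (hn : #|T| = n)
    (hk : 1 <= k) (hX : X \subset edges e) (hXk : #|X| <= k)
    (hdeg : forall x y : T, e x y -> n + k <= degree e x + degree e y) :
  (exists (x : T) (p : seq T),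
      [/\ closed_trail e x p, spanning x p
        & forall E : {set T}, E \in X -> E \in walk_edges x p])
  \/ (~~ odd n /\ isomorphic e (@K2star (n - 2))).
Proof.
have [sym_e irr_e] := hG; have [T_gt0 conn_e] := hconn; subst n.
case: (connected_even_cover sym_e irr_e hk hX hXk hdeg conn_e); last by right.
case=> H [sHe evH sXH connH]; left.
have [x [p [trp spanp Hp]]] := euler sym_e irr_e sHe evH connH T_gt0.
by exists x, p; split=> // E /(subsetP sXH)/Hp.
Qed.
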